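(* Let $Q=\{(x,y)\in[0,1]^n\times[0,1]^n\mid\sum_{i=1}^n a_ix_iy_i\ge d\}$, where $a_i$, $i\in[n]$, form a minimal cover of $d$. Let $d_i:=d-\sum_{j\in[n]\setminus\{i\}}a_j$ for $i\in[n]$. Then the bilinear cover inequality $$\sum_{i=1}^n\frac{\sqrt{a_i}}{\sqrt{a_i}-\sqrt{d_i}}\left(\sqrt{x_iy_i}-1\right)\ge-1$$ is valid for $Q$, i.e., it is satisfied by every $(x,y)\in Q$.
   Context: $[n]=\{1,\dots,n\}$. Real numbers $a_1,\dots,a_n$ ($n\ge1$) form a minimal cover of $d\in\mathbb{R}$ if (i) $a_i>0$ for all $i\in[n]$ and $d>0$, (ii) $\sum_{i=1}^na_i>d$, and (iii) $\sum_{i\in K}a_i\le d$ for every $K\subsetneq[n]$. (With $\Delta:=\sum_{i=1}^na_i-d$, this gives $\Delta>0$, $a_i\ge\Delta$ and $d_i=a_i-\Delta\ge0$, so the expressions are well defined.) *)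

(* Defs.v *)
From mathcomp Require Import all_boot all_order all_algebra.
From mathcomp Require Import classical_sets reals.

Set Implicit Arguments.
Unset Strict Implicit.
Unset Printing Implicit Defensive.

Import Order.TTheory GRing.Theory Num.Theory.
Local Open Scope ring_scope.

Definition minimal_cover (R : realType) (n : nat) (a : 'rV[R]_n) (d : R) : Prop :=
  [/\ (0 < n)%N,
      (forall i : 'I_n, 0 < a 0 i) /\ 0 < d,
      d < \sum_(i < n) a 0 i
    & forall K : {set 'I_n}, K \proper [set: 'I_n]%SET ->
        \sum_(i in K) a 0 i <= d].

(* The d_i of the inequality; for a minimal cover it lies in [0, a_i), so
   neither square root nor the denominator in which it is used degenerates. *)
Definition cover_residual (R : realType) (n : nat) (a : 'rV[R]_n) (d : R)
    (i : 'I_n) : R :=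
  d - \sum_(j < n | j != i) a 0 j.

Definition bilinear_cover_set (R : realType) (n : nat) (a : 'rV[R]_n) (d : R) :
    set ('rV[R]_n * 'rV[R]_n) :=
  [set xy : 'rV[R]_n * 'rV[R]_n |
     [/\ forall i : 'I_n, 0 <= xy.1 0 i <= 1,
         forall i : 'I_n, 0 <= xy.2 0 i <= 1
       & d <= \sum_(i < n) a 0 i * xy.1 0 i * xy.2 0 i]]%classic.

(* Main.v *)
Require Import Defs.
From mathcomp Require Import all_boot all_order all_algebra.
From mathcomp Require Import classical_sets reals.
From mathcomp Require Import ring lra.

Import Order.TTheory GRing.Theory Num.Theory.
Local Open Scope ring_scope.

(** Put [D := \sum_i a_i - d > 0], so that [d_i = a_i - D], and
    [u_i := sqrt (x_i * y_i)].  The constraint says that the nonnegative losses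
    [s_i := a_i * (1 - u_i ^+ 2)] add up to at most [D]; in particular each of
    them lies in [0, D].  In terms of the loss, minus the [i]-th summand of the
    inequality is
    [sqrt a_i / (sqrt a_i - sqrt d_i) * (1 - sqrt (1 - s_i / a_i))], a convex
    function of [s_i] with value 0 at 0 and 1 at [D].  It therefore lies below
    its chord [s_i / D] on [0, D] ([bilinear_term_ge_chord], made applicable by
    [cover_residual_le]), and adding the chord bounds leaves
    [(\sum_i s_i) / D <= 1]. *)

(** The chord bound with [b = sqrt a_i], [c = sqrt d_i], [b ^+ 2 - c ^+ 2 = D].
    After clearing denominators both sides share the factor [b * (1 - u)], and
    what remains is [b + c <= b + b * u]; so [c <= b * u], which says that the
    loss is at most [D], is exactly what convexity needs. *)
Lemma bilinear_term_ge_chord (R : realFieldType) (b c u : R) :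
  0 <= c -> c < b -> u <= 1 -> c <= b * u ->
  b ^+ 2 * (u ^+ 2 - 1) / (b ^+ 2 - c ^+ 2) <= b / (b - c) * (u - 1).
Proof.
move=> c0 cb u1 cbu.
have bc_gt0 : 0 < b - c by rewrite subr_gt0.
have bDc_gt0 : 0 < b + c by lra.
have D_gt0 : 0 < b ^+ 2 - c ^+ 2 by rewrite subr_sqr mulr_gt0.
have -> : b / (b - c) * (u - 1) = b * (b + c) * (u - 1) / (b ^+ 2 - c ^+ 2).
  by field; rewrite !gt_eqF.
rewrite ler_pM2r ?invr_gt0 // -subr_ge0.
have -> : b * (b + c) * (u - 1) - b ^+ 2 * (u ^+ 2 - 1)
          = b * ((1 - u) * (b * u - c)) by ring.
by rewrite !mulr_ge0 ?subr_ge0 // ltW // (le_lt_trans c0 cb).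
Qed.

Lemma cover_residualE (R : realType) (n : nat) (a : 'rV[R]_n) (d : R)
    (i : 'I_n) :
  cover_residual a d i = a 0 i - (\sum_(j < n) a 0 j - d).
Proof. by rewrite /cover_residual [in RHS](bigD1 i) //=; ring. Qed.

Lemma cover_residual_ge0 (R : realType) (n : nat) (a : 'rV[R]_n) (d : R)
    (i : 'I_n) :
  minimal_cover a d -> 0 <= cover_residual a d i.
Proof.
case=> _ _ _ /(_ [set~ i]%SET) hK; rewrite subr_ge0.
have /hK : [set~ i]%SET \proper [set: 'I_n]%SET.
  by rewrite properE finset.subsetT; apply/subsetPn; exists i; rewrite !inE ?eqxx.
by congr (_ <= d); apply: eq_bigl => j; rewrite !inE.
Qed.

(** Even if all other variables are at their upper bound 1, the [i]-th one
    has to supply the residual demand. *)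
Lemma cover_residual_le (R : realType) (n : nat) (a z : 'rV[R]_n) (d : R)
    (i : 'I_n) :
  (forall j, 0 <= a 0 j) -> (forall j, z 0 j <= 1) ->
  d <= \sum_(j < n) a 0 j * z 0 j -> cover_residual a d i <= a 0 i * z 0 i.
Proof.
move=> a_ge0 z_le1; rewrite (bigD1 i) //= => hd.
rewrite lerBlDr; apply: le_trans hd _; rewrite lerD2l.
by apply: ler_sum => j _; rewrite ler_piMr.
Qed.

Theorem theorem3 (R : realType) (n : nat) (a : 'rV[R]_n) (d : R)
    (ha : minimal_cover a d) :
  forall x y : 'rV[R]_n, bilinear_cover_set a d (x, y) ->
    \sum_(i < n)
       Num.sqrt (a 0 i) /
         (Num.sqrt (a 0 i) - Num.sqrt (cover_residual a d i)) *
       (Num.sqrt (x 0 i * y 0 i) - 1) >= -1.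
Proof.
move=> x y [/= hx hy hd].
have res_ge0 i := @cover_residual_ge0 _ _ _ _ i ha.
case: ha => _ [a_gt0 _] sum_gt _.
pose z := \row_i (x 0 i * y 0 i).
have z_ge0 i : 0 <= z 0 i.
  by rewrite mxE; case/andP: (hx i) (hy i) => ? _ /andP[? _]; apply: mulr_ge0.
have z_le1 i : z 0 i <= 1.
  by rewrite mxE; case/andP: (hx i) (hy i) => ? ? /andP[? ?]; apply: mulr_ile1.
have hdz : d <= \sum_(i < n) a 0 i * z 0 i.
  by apply: le_trans hd _; apply: ler_sum => i _; rewrite mxE mulrA.
pose D := \sum_(i < n) a 0 i - d.
have D_gt0 : 0 < D by rewrite subr_gt0.
apply: (@le_trans _ _ (\sum_(i < n) a 0 i * (z 0 i - 1) / D)).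
  rewrite -mulr_suml ler_pdivlMr // mulN1r.
  under eq_bigr => i _ do rewrite mulrBr mulr1.
  by rewrite big_split sumrN /= /D; lra.
apply: ler_sum => i _.
have resE := cover_residualE _ _ a d i.
have sqrtaE : Num.sqrt (a 0 i) ^+ 2 = a 0 i by rewrite sqr_sqrtr // ltW.
have sqrtzE : Num.sqrt (z 0 i) ^+ 2 = z 0 i by rewrite sqr_sqrtr.
have -> : x 0 i * y 0 i = z 0 i by rewrite mxE.
have DE : D = Num.sqrt (a 0 i) ^+ 2 - Num.sqrt (cover_residual a d i) ^+ 2.
  by rewrite sqrtaE sqr_sqrtr // resE /D; ring.
rewrite -[X in X * (_ - 1) / D]sqrtaE -[X in _ * (X - 1) / D]sqrtzE DE.
apply: bilinear_term_ge_chord.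
- exact: sqrtr_ge0.
- by rewrite ltr_sqrt // resE gtrBl.
- by rewrite -sqrtr1 ler_wsqrtr.
- rewrite -sqrtrM ?(ltW (a_gt0 i)) //; apply: ler_wsqrtr.
  by apply: cover_residual_le => // j; apply: ltW.
Qed.
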